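(* Let $\lambda$ be a partition of $n$ and let $S$ be any filling of the boxes of $\lambda$ with nonnegative integers. If at least one element of $B_\lambda^S=\{F_T^S : T\in\mathrm{SYT}(\lambda)\}$ is nonzero, then all elements of $B_\lambda^S$ are nonzero and they span a copy of $M_\lambda$ in the polynomial ring $\mathbb{C}[x_1,\dots,x_n]$ (i.e. their span is an $\mathfrak S_n$-submodule isomorphic to $M_\lambda$).
   Context: Young diagrams are in French notation (the first, largest part is the bottom row). $\mathrm{SYT}(\lambda)$ is the set of standard Young tableaux of shape $\lambda$ (entries $1,\dots,n$, increasing left to right in rows and bottom to top in columns). $\mathfrak S_n$ acts on $\mathbb{C}[x_1,\dots,x_n]$ by $\sigma x_i=x_{\sigma(i)}$. For a bijective filling $T$ of $\lambda$ by $1,\dots,n$, $\mathcal R(T),\mathcal C(T)\subseteq\mathfrak S_n$ are the subgroups preserving the set of entries of each row, respectively column, of $T$, and $\varepsilon_T=\sum_{\tau\in\mathcal C(T)}\sum_{\sigma\in\mathcal R(T)}(-1)^\tau\,\tau\sigma$. Put $\mathbf{x}_T^S=\prod_{b\in\lambda}x_{T(b)}^{S(b)}$ (product over boxes $b$ of $\lambda$) and $F_T^S=\varepsilon_T\mathbf{x}_T^S$. The Specht polynomial of a bijective filling $T$ is $g_T=\prod_{c}\prod_{i\text{ above }j\text{ in }c}(x_i-x_j)$, where $c$ ranges over the columns of $T$. The Specht module is $M_\lambda=\mathrm{span}\{g_T\}\subseteq\mathbb{C}[x_1,\dots,x_n]$, where $T$ ranges over all bijective fillings of $\lambda$ with $1,\dots,n$;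 it is isomorphic to the irreducible $\mathfrak S_n$-module $V_\lambda$. *)

(* Defs.v *)
From HB Require Import structures.
From mathcomp Require Import all_boot all_fingroup all_algebra.
From mathcomp Require Import mpoly complex.
From mathcomp Require Import boolp classical_sets functions reals.

Set Implicit Arguments.
Unset Strict Implicit.
Unset Printing Implicit Defensive.

Import GRing.Theory.

Local Open Scope classical_set_scope.
Local Open Scope ring_scope.

Definition is_partition (n : nat) (la : seq nat) : bool :=
  [&& sorted geq la, 0%N \notin la & sumn la == n].

(* French notation, with rows and columns numbered from 0: row 0 is the bottom
   row, of length the largest part, and "above" means a larger row index. *)
Definition box (la : seq nat) : finType :=
  {i : 'I_(size la) & 'I_(nth 0%N la i)}.
Definition brow (la : seq nat) (b : box la) : nat := tag b.
Definition bcol (la : seq nat) (b : box la) : nat := tagged b.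

(* The entries 1, ..., n are represented by the ordinals 0, ..., n - 1, which
   also index the variables of {mpoly C[n]}. *)
Definition filling (n : nat) (la : seq nat) : finType :=
  {ffun box la -> 'I_n}.

Definition SYT (n : nat) (la : seq nat) : set (filling n la) :=
  [set T : filling n la | [/\ bijective T,
    forall b b', brow b = brow b' -> (bcol b < bcol b')%N -> (T b < T b')%N &
    forall b b', bcol b = bcol b' -> (brow b < brow b')%N -> (T b < T b')%N]].

Section Polynomials.
Variables (C : fieldType) (n : nat).
Implicit Types (p q : {mpoly C[n]}) (U V : set {mpoly C[n]}).

Definition mpoly_span U : set {mpoly C[n]} :=
  [set p | exists (m : nat) (c : 'I_m -> C) (u : 'I_m -> {mpoly C[n]}),
     (forall i, U (u i)) /\ p = \sum_(i < m) c i *: u i].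

(* [msym s] is the algebra endomorphism with msym s 'X_i = 'X_(s i), i.e., the
   left action of s; [(s * t)%g] means "s, then t" in MathComp, so that
   msym (s * t) p = msym t (msym s p). *)
Definition Sn_submodule U : Prop :=
  [/\ U 0, forall (a : C) p q, U p -> U q -> U (a *: p + q)
    & forall (s : 'S_n) p, U p -> U (msym s p)].

(* Only the values of f on U matter. *)
Definition Sn_isomorphic U V : Prop :=
  exists f : {mpoly C[n]} -> {mpoly C[n]},
    [/\ forall (a : C) p q, U p -> U q -> f (a *: p + q) = a *: f p + f q,
        forall (s : 'S_n) p, U p -> f (msym s p) = msym s (f p)
      & set_bij U V f].

Variable la : seq nat.
Implicit Types (T : filling n la) (S : box la -> nat).

Definition row_entries T (r : nat) : {set 'I_n} :=
  [set T b | b in [pred b : box la | brow b == r]]%SET.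
Definition col_entries T (c : nat) : {set 'I_n} :=
  [set T b | b in [pred b : box la | bcol b == c]]%SET.

Definition row_group T : {set 'S_n} :=
  [set s : 'S_n | [forall r : 'I_(size la),
     [set s i | i in row_entries T r] == row_entries T r]]%SET.
Definition col_group T : {set 'S_n} :=
  [set t : 'S_n | [forall c : 'I_(head 0%N la),
     [set t i | i in col_entries T c] == col_entries T c]]%SET.

Definition young_symmetrizer T p : {mpoly C[n]} :=
  \sum_(t in col_group T) \sum_(s in row_group T)
    (-1) ^+ odd_perm t *: msym t (msym s p).

Definition filling_monomial T S : {mpoly C[n]} :=
  \prod_(b : box la) 'X_(T b) ^+ S b.

Definition specht_F S T : {mpoly C[n]} :=
  young_symmetrizer T (filling_monomial T S).

Definition specht_B S : set {mpoly C[n]} := [set specht_F S T | T in @SYT n la].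

Definition specht_polynomial T : {mpoly C[n]} :=
  \prod_(c < head 0%N la)
    \prod_(p : box la * box la |
        [&& bcol p.1 == c, bcol p.2 == c & (brow p.2 < brow p.1)%N])
      ('X_(T p.1) - 'X_(T p.2)).

Definition specht_module : set {mpoly C[n]} :=
  mpoly_span [set specht_polynomial T | T in [set T : filling n la | bijective T]].

End Polynomials.

Arguments specht_B C n {la} S.
Arguments specht_module C n la : clear implicits.

(* Main.v *)
From HB Require Import structures.
Require Import Defs.
From mathcomp Require Import all_boot all_order all_fingroup all_algebra.
From mathcomp Require Import mpoly complex.
From mathcomp Require Import zify.
From mathcomp Require Import boolp classical_sets functions reals.

(** The filling [w \o T] is written as a translate of T: both the polynomials
    F_T^S = e_T x_T^S and the Specht polynomials g_T satisfy F_{wT} = w F_T and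
    g_{wT} = w g_T.  Hence if one F_T^S is nonzero, then so are all of them, and
    everything takes place in the cyclic modules generated by F = F_{T0}^S and
    g = g_{T0} for one fixed standard tableau T0, with rows [ro] and columns [co].

    Write e = D R for the Young symmetrizer of T0, where D is the signed sum over
    the column group and R the sum over the row group.  For every permutation w
    one has D w R = k D R for a constant k ([csum_msym_rsum]): either two entries
    of one row are sent by w to one column and D w R = 0, or w is a row
    permutation followed by a column permutation.  The coefficientwise Hermitian
    product of polynomials is invariant, so that D is self-adjoint, and D D is a
    nonzero multiple of D.  For a in the group algebra, |a e p|^2 is the product
    of R p and D a* a D R p, hence |a e p|^2 = k |e p|^2 with k independent of p
    ([act_ysym_norm]).  Therefore, if e p is nonzero and a e p = 0, then a e q = 0
    for all q ([act_ysym_eq0]): all nonzero polynomials in the image of e have the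
    same annihilator.

    The Specht polynomial g is in the image of e ([specht_eq_ysym]).  Indeed g is
    antisymmetric under the column group, and the degree of g in each variable is
    less than the height of its column; in a monomial of g the exponents in each
    column are then distinct, and are a permutation of the rows, so that g is a
    multiple of D applied to the monomial with the rows as exponents.  Hence F and
    g have the same annihilator and a F |-> a g is an isomorphism of cyclic
    modules ([cyclic_isomorphic]).

    It remains to see that the standard tableaux suffice to span the module
    generated by F.  By the same annihilator argument this may be checked for g,
    where it is the classical straightening ([specht_straightening]).  If two
    entries of a column are in the wrong order, they are exchanged.  If two
    entries of a row are in the wrong order, then the Garnir relation
    ([garnir_relation]), which again follows by counting exponents, expresses the
    Specht polynomial through others for which larger entries are further to the
    right. *)

Set Implicit Arguments.
Unset Strict Implicit.
Unset Printing Implicit Defensive.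

Import Order.TTheory GRing.Theory Num.Theory.

Local Open Scope ring_scope.

(** * The group algebra acting on polynomials *)

Section GroupAlgebra.
Variables (C : numClosedFieldType) (n : nat).
Implicit Types (p q : {mpoly C[n]}) (a b : 'S_n -> C) (s t w : 'S_n).

(** The action on polynomials of the element [\sum_s a s * s] of the group
    algebra of the symmetric group. *)
Definition act a p : {mpoly C[n]} := \sum_s a s *: msym s p.

Lemma act_is_linear a : linear (act a).
Proof.
move=> c p q; rewrite /act scaler_sumr -big_split; apply: eq_bigr => s _ /=.
by rewrite linearP scalerDr !scalerA mulrC.
Qed.

HB.instance Definition _ a :=
  GRing.isLinear.Build C {mpoly C[n]} {mpoly C[n]} _ (act a)
    (act_is_linear a).

Lemma eq_act a b p : a =1 b -> act a p = act b p.
Proof. by move=> eq_ab; apply: eq_bigr => s _; rewrite eq_ab. Qed.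

Lemma actDl a b c p :
  act (fun s => c * a s + b s) p = c *: act a p + act b p.
Proof.
rewrite /act scaler_sumr -big_split; apply: eq_bigr => s _ /=.
by rewrite scalerDl scalerA.
Qed.

Lemma act_delta w p : act (fun s => (s == w)%:R) p = msym w p.
Proof.
rewrite /act (bigD1 w) //= eqxx scale1r big1 ?addr0 // => s /negPf->.
by rewrite scale0r.
Qed.

Lemma msym_act w a p : msym w (act a p) = act (fun s => a (s * w^-1)%g) p.
Proof.
rewrite /act linear_sum /= [RHS](reindex_inj (mulIg w)) /=.
by apply: eq_bigr => s _; rewrite mulgK msymZ msymMm.
Qed.

Lemma act_msym w a p : act a (msym w p) = act (fun s => a (w^-1 * s)%g) p.
Proof.
rewrite /act [RHS](reindex_inj (mulgI w)) /=.
by apply: eq_bigr => s _; rewrite mulKg msymMm.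
Qed.

(** Since [(s * t)%g] applies s first, the product in the group algebra that
    corresponds to composing the actions is the opposite convolution. *)
Definition conv a b s : C := \sum_t b t * a (t^-1 * s)%g.

Lemma act_comp a b p : act a (act b p) = act (conv a b) p.
Proof.
rewrite [act b p]/act linear_sum /= [RHS]/act.
under [RHS]eq_bigr do rewrite scaler_suml.
rewrite [RHS]exchange_big; apply: eq_bigr => t _ /=.
rewrite linearZ /= act_msym /act scaler_sumr.
by apply: eq_bigr => s _; rewrite scalerA.
Qed.

(** The Hermitian form for which the monomials of degree less than [d] are
    orthonormal and the other ones are orthogonal to everything; the truncation
    makes the index set of the sum independent of the polynomials. *)
Definition form (d : nat) p q : C := \sum_(m : 'X_{1..n < d}) p@_m * (q@_m)^*.

Lemma form_suml d (I : finType) (F : I -> {mpoly C[n]}) q :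
  form d (\sum_i F i) q = \sum_i form d (F i) q.
Proof.
rewrite /form exchange_big; apply: eq_bigr => m _ /=.
by rewrite raddf_sum mulr_suml.
Qed.

Lemma form_sumr d (I : finType) (F : I -> {mpoly C[n]}) p :
  form d p (\sum_i F i) = \sum_i form d p (F i).
Proof.
rewrite /form exchange_big; apply: eq_bigr => m _ /=.
by rewrite raddf_sum rmorph_sum mulr_sumr.
Qed.

Lemma formZl d c p q : form d (c *: p) q = c * form d p q.
Proof.
by rewrite /form mulr_sumr; apply: eq_bigr => m _; rewrite mcoeffZ mulrA.
Qed.

Lemma formZr d c p q : form d p (c *: q) = c^* * form d p q.
Proof.
rewrite /form mulr_sumr; apply: eq_bigr => m _.
by rewrite mcoeffZ rmorphM mulrCA.
Qed.

Lemma form_msym d s p q : form d (msym s p) (msym s q) = form d p q.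
Proof.
have Pm w (m : 'X_{1..n < d}) : (mdeg [multinom m (w i) | i < n] < d)%N.
  by rewrite mdeg_mperm bmdeg.
pose h w (m : 'X_{1..n < d}) := BMultinom (Pm w m).
rewrite /form [RHS](reindex (h s)) /=; last first.
  by exists (h s^-1%g) => m _; apply/val_inj; apply/mnmP => i;
    rewrite /= !mnmE ?permK ?permKV.
by apply: eq_bigr => m _; rewrite !mcoeff_sym.
Qed.

Lemma form_adjoint d s p q : form d (msym s p) q = form d p (msym s^-1%g q).
Proof. by rewrite -(form_msym d s p) -msymMm mulVg msym1m. Qed.

(** The adjoint of the action of a group algebra element. *)
Definition star a s : C := (a s^-1%g)^*.

Lemma act_adjoint d a p q : form d (act a p) q = form d p (act (star a) q).
Proof.
rewrite /act form_suml form_sumr (reindex_inj invg_inj) /=.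
apply: eq_bigr => s _; rewrite formZl formZr form_adjoint invgK.
by rewrite /star conjCK.
Qed.

Lemma form_eq0 p : (forall d, form d p p = 0) -> p = 0.
Proof.
move=> p0; apply/mpolyP => m; rewrite mcoeff0.
have := p0 (mdeg m).+1; rewrite /form => /eqP.
rewrite psumr_eq0 => [/allP/(_ (BMultinom (ltnSn (mdeg m))))|m' _].
  by rewrite mem_index_enum mul_conjC_eq0 => /(_ isT)/eqP.
exact: mul_conjC_ge0.
Qed.

Lemma form_neq0 p : p != 0 -> exists d, form d p p != 0.
Proof.
move=> /eqP p0; apply: contrapT => Np; apply/p0/form_eq0 => d.
by apply: contrapT => /eqP Nd; apply: Np; exists d.
Qed.

End GroupAlgebra.

(** * Signed and plain sums over a group of permutations *)

Section GroupSums.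
Variables (C : numClosedFieldType) (n : nat) (G : {group 'S_n}).
Implicit Types (p : {mpoly C[n]}) (s t : 'S_n).

(** The coefficients of the signed and of the plain sum over G. *)
Definition signed s : C := (-1) ^+ odd_perm s *+ (s \in G).
Definition plain s : C := (s \in G)%:R.

Lemma act_signedE p :
  act signed p = \sum_(s in G) (-1) ^+ odd_perm s *: msym s p.
Proof.
rewrite /act [RHS]big_mkcond; apply: eq_bigr => s _; rewrite /signed.
by case: (s \in G); rewrite ?scale0r.
Qed.

Lemma act_plainE p : act plain p = \sum_(s in G) msym s p.
Proof.
rewrite /act [RHS]big_mkcond; apply: eq_bigr => s _; rewrite /plain.
by case: (s \in G); rewrite ?scale0r ?scale1r.
Qed.

Lemma star_signed : star signed =1 signed.
Proof.
move=> s; rewrite /star /signed groupV odd_permV.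
by rewrite rmorphMn rmorphXn rmorphN rmorph1.
Qed.

Lemma signed_msym t p :
  t \in G -> act signed (msym t p) = (-1) ^+ odd_perm t *: act signed p.
Proof.
move=> Gt; rewrite act_msym /act scaler_sumr; apply: eq_bigr => s _.
rewrite /signed groupMl ?groupV // odd_permM odd_permV signr_addb scalerA.
by rewrite mulrnAr.
Qed.

Lemma msym_signed t p :
  t \in G -> msym t (act signed p) = (-1) ^+ odd_perm t *: act signed p.
Proof.
move=> Gt; rewrite msym_act /act scaler_sumr; apply: eq_bigr => s _.
rewrite /signed groupMr ?groupV // odd_permM odd_permV signr_addb scalerA.
by rewrite mulrnAr mulrC.
Qed.

Lemma act_signed_antisym p :
  (forall t, t \in G -> msym t p = (-1) ^+ odd_perm t *: p) ->
  act signed p = #|G|%:R *: p.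
Proof.
move=> anti; rewrite act_signedE (eq_bigr (fun=> p)); last first.
  by move=> t /anti->; rewrite scalerA -signr_addb addbb scale1r.
by rewrite sumr_const scaler_nat.
Qed.

Lemma signed_idem p : act signed (act signed p) = #|G|%:R *: act signed p.
Proof. by apply: act_signed_antisym => t; apply: msym_signed. Qed.

Lemma msym_plain t p : t \in G -> msym t (act plain p) = act plain p.
Proof.
move=> Gt; rewrite msym_act; apply: eq_act => s.
by rewrite /plain groupMr ?groupV.
Qed.

Lemma signed_tperm_eq0 i j p :
  i != j -> tperm i j \in G -> msym (tperm i j) p = p -> act signed p = 0.
Proof.
move=> ij Gt tp; have := signed_msym p Gt.
rewrite tp odd_tperm ij expr1 scaleN1r => /eqP.
by rewrite -addr_eq0 -mulr2n -scaler_nat scaler_eq0 pnatr_eq0 => /eqP.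
Qed.

End GroupSums.

Arguments signed C {n} G.
Arguments plain C {n} G.

(** * Diagram coordinates *)

(** The permutations that preserve a labelling. *)
Definition stab n (f : 'I_n -> nat) : {set 'S_n} :=
  [set s : 'S_n | [forall i, f (s i) == f i]]%SET.

Lemma stabP n (f : 'I_n -> nat) (s : 'S_n) :
  reflect (forall i, f (s i) = f i) (s \in stab f).
Proof. by rewrite inE; apply: (iffP forallP) => h i; apply/eqP. Qed.

Lemma stab_group_set n (f : 'I_n -> nat) : group_set (stab f).
Proof.
apply/group_setP; split=> [|s t /stabP fs /stabP ft]; apply/stabP => i.
  by rewrite perm1.
by rewrite permM ft fs.
Qed.

Canonical stab_group n (f : 'I_n -> nat) := Group (stab_group_set f).

Lemma tperm_stab n (f : 'I_n -> nat) i j :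
  f i = f j -> tperm i j \in stab f.
Proof. by move=> fij; apply/stabP => k; case: tpermP => [->|->|]. Qed.

(** A permutation that preserves a labelling is a product of transpositions of
    elements with the same label: if s moves [i], then the transposition of [s i]
    and [i] after s fixes [i] and all fixed points of s. *)
Lemma stab_ind n (f : 'I_n -> nat) (P : 'S_n -> Prop) :
    P 1%g ->
    (forall i j s, i != j -> f i = f j -> s \in stab f -> P s ->
       P (s * tperm i j)%g) ->
  forall s, s \in stab f -> P s.
Proof.
move=> P1 Pt s; have [m] := ubnP #|[set i | s i != i]%SET|.
elim: m s => // m IHm s; rewrite ltnS => sm sf.
have [/eqP s0 | [ i ]] := set_0Vmem [set i | s i != i]%SET.
  suff -> : s = 1%g by [].
  apply/permP => i; rewrite perm1; apply/eqP; apply: contraTT s0 => si.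
  by apply/set0Pn; exists i; rewrite inE.
rewrite inE => si; have fsi : f (s i) = f i by apply: (stabP _ _ sf).
have tf : tperm (s i) i \in stab f by apply: tperm_stab.
rewrite -[s](mulgK (tperm (s i) i)) tpermV.
apply: Pt => //; first by rewrite groupM.
apply: IHm; last by rewrite groupM.
apply: leq_trans sm; apply: proper_card; apply/properP; split; last first.
  by exists i; rewrite !inE // permM tpermL eqxx.
apply/fintype.subsetP => k; rewrite !inE permM; apply: contra => /eqP sk.
have ki : k != i by apply: contraNneq si => <-; rewrite sk.
by rewrite sk tpermD // eq_sym // -sk (inj_eq perm_inj).
Qed.

Lemma card_inj_le n (A : {set 'I_n}) (f : 'I_n -> nat) r :
    {in A &, injective f} -> (forall i, i \in A -> (f i < r)%N) ->
  (#|A| <= r)%N.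
Proof.
move=> finj flt; rewrite cardE -(size_map f) -(size_iota 0 r).
apply: uniq_leq_size.
  by rewrite map_inj_in_uniq ?enum_uniq // => i j; rewrite !mem_enum; apply: finj.
by move=> k /mapP[x]; rewrite mem_enum mem_iota => /flt fx ->.
Qed.

Lemma card_surj_ge n (A : {set 'I_n}) (f : 'I_n -> nat) r :
    (forall k, (k < r)%N -> exists2 i, i \in A & f i = k) -> (r <= #|A|)%N.
Proof.
move=> fsurj; rewrite cardE -(size_map f) -(size_iota 0 r).
apply: uniq_leq_size (iota_uniq _ _) _ => k.
rewrite mem_iota /= add0n => /fsurj[i Ai <-].
by apply: map_f; rewrite mem_enum.
Qed.

Lemma sum_card_fibres n (f : 'I_n -> nat) (P : pred 'I_n) B :
    (forall i, (f i < B)%N) ->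
  (\sum_(c < B) #|[set i | (f i == c) && P i]%SET| = #|[set i | P i]%SET|)%N.
Proof.
move=> fB; rewrite -sum1dep_card (partition_big (fun i => Ordinal (fB i)) xpredT) //=.
apply: eq_bigr => c _; rewrite -sum1dep_card; apply: eq_bigl => i.
by rewrite andbC -val_eqE.
Qed.

(** The functions [ro] and [co] give the row and the column of each entry of a
    bijective filling of a Young diagram: they form an injection whose image is
    closed under decreasing either coordinate. *)
Definition diagram_coordinates n (ro co : 'I_n -> nat) : Prop :=
  (forall i j, ro i = ro j -> co i = co j -> i = j) /\
  (forall i r c, (r <= ro i)%N -> (c <= co i)%N ->
     exists2 j, ro j = r & co j = c).

Section Coordinates.
Variables (n : nat) (ro co : 'I_n -> nat).
Hypothesis diag : diagram_coordinates ro co.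

(** The number of entries in the column [c]. *)
Definition height c : nat := #|[set i | co i == c]%SET|.

Lemma card_column_le c r :
  (#|[set i | (co i == c) && (ro i < r)%N]%SET| <= r)%N.
Proof.
apply: (@card_inj_le _ _ ro) => [i j|i]; rewrite !inE; last by case/andP.
by move=> /andP[/eqP ci _] /andP[/eqP cj _] rij; apply: diag.1 => //; rewrite ci.
Qed.

Lemma height_exists c r : (r < height c)%N -> exists2 i, ro i = r & co i = c.
Proof.
move=> rc; apply: contrapT => Nex; move: rc; rewrite ltnNge => /negP; apply.
apply: leq_trans (card_column_le c r); apply: subset_leq_card.
apply/fintype.subsetP => i; rewrite !inE => /eqP ci; rewrite ci eqxx /= ltnNge.
by apply/negP => ri; apply: Nex; apply: (diag.2 i) => //; rewrite ci.
Qed.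

Lemma ltn_height i : (ro i < height (co i))%N.
Proof.
apply: (@card_surj_ge _ _ ro) => r; rewrite ltnS => ri.
by have [j rj cj] := diag.2 _ _ _ ri (leqnn _); exists j; rewrite // inE cj.
Qed.

Lemma card_column c r :
  #|[set i | (co i == c) && (ro i < r)%N]%SET| = minn r (height c).
Proof.
apply/eqP; rewrite eqn_leq leq_min card_column_le /=; apply/andP; split.
  by apply: subset_leq_card; apply/fintype.subsetP => i; rewrite !inE => /andP[].
apply: (@card_surj_ge _ _ ro) => k; rewrite leq_min => /andP[kr /height_exists].
by move=> [i ri ci]; exists i; rewrite // inE ci eqxx ri.
Qed.

Lemma leq_height c c' : (c <= c')%N -> (height c' <= height c)%N.
Proof.
move=> cc'; case E: (height c') => [//|h].
have [i ri ci] : exists2 i, ro i = h & co i = c'.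
  by apply: height_exists; rewrite E.
have [||j rj cj] := diag.2 i h c; rewrite ?ri ?ci //.
by rewrite -rj -cj ltn_height.
Qed.

(** If w never sends two entries of the same row to the same column, then the
    box in the row of [ i ] and in the column of [w i] exists: otherwise, in the
    rows below it, counting by columns would leave too few places. *)
Lemma row_lt_height_image (w : 'S_n) :
    (forall i j, i != j -> ro i = ro j -> co (w i) <> co (w j)) ->
  forall i, (ro i < height (co (w i)))%N.
Proof.
move=> wP i0; rewrite ltnNge; apply/negP => hk.
pose B := (\max_i co i).+1.
have coB i : (co i < B)%N by rewrite ltnS leq_bigmax.
have := sum_card_fibres (fun i => (ro i < ro i0)%N) (fun i => coB (w i)).
rewrite -(sum_card_fibres (fun i => (ro i < ro i0)%N) coB) => /eqP.
apply/negP; rewrite neq_ltn; apply/orP; left.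
have le_height c (A : {set 'I_n}) : A \subset [set i | co (w i) == c]%SET ->
    (#|A| <= height c)%N.
  move=> sA; rewrite -(card_imset _ (@perm_inj _ w)); apply: subset_leq_card.
  by apply/fintype.subsetP => k /imsetP[i /(fintype.subsetP sA)]; rewrite !inE => ci ->.
rewrite (bigD1 (Ordinal (coB (w i0)))) //=.
rewrite [ltnRHS](bigD1 (Ordinal (coB (w i0)))) //=.
rewrite -addSn leq_add //; last first.
  apply: leq_sum => c _; rewrite card_column leq_min; apply/andP; split.
    apply: (@card_inj_le _ _ ro) => [i j|i]; rewrite !inE; last by case/andP.
    move=> /andP[/eqP ci _] /andP[/eqP cj _] rij.
    by apply/eqP/negPn/negP => /wP/(_ rij); rewrite ci cj.
  by apply: le_height; apply/fintype.subsetP => i; rewrite !inE => /andP[].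
rewrite card_column (minn_idPr hk).
set A := [set i | _]%SET; have Ai0 : i0 \notin A by rewrite inE ltnn andbF.
have := le_height (co (w i0)) (i0 |: A)%SET; rewrite cardsU1 Ai0; apply.
by apply/fintype.subsetP => i; rewrite !inE => /orP[/eqP->|/andP[]].
Qed.

(** Two fillings such that no two entries are in the same row of one and in the
    same column of the other differ by a column and a row permutation. *)
Lemma perm_row_column_factor (w : 'S_n) :
    (forall i j, i != j -> ro i = ro j -> co (w i) <> co (w j)) ->
  exists s t, [/\ s \in stab ro, t \in stab co & w = (s * t)%g].
Proof.
move=> wP; have ex i : exists j, ro j = ro i /\ co j = co (w i).
  have [j rj cj] := height_exists (row_lt_height_image wP i).
  by exists j.
have [f fP] := fin_all_exists ex.
have finj : injective f.
  move=> i j fij; apply/eqP/negPn/negP => ij.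
  have [[ri ci] [rj cj]] := (fP i, fP j).
  by apply: (wP i j) => //; rewrite -?ri -?ci fij.
pose s := perm finj.
exists s, (s^-1 * w)%g; rewrite mulKVg; split=> //; apply/stabP => i.
  by rewrite permE (fP i).1.
by rewrite permM -(fP (s^-1 i)%g).2 -[f _](permE finj) permKV.
Qed.

End Coordinates.

(** * The Young symmetrizer *)

Section Symmetrizer.
Variables (C : numClosedFieldType) (n : nat) (ro co : 'I_n -> nat).
Hypothesis diag : diagram_coordinates ro co.
Implicit Types (p q : {mpoly C[n]}) (a : 'S_n -> C).

(** The plain sum over the row group and the signed sum over the column group. *)
Local Notation rsum := (act (plain C (stab_group ro))).
Local Notation csum := (act (signed C (stab_group co))).

(** The Young symmetrizer of the filling with rows [ro] and columns [co]. *)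
Definition ysym p : {mpoly C[n]} := csum (rsum p).

(** A transposition of two entries in the same row that w sends to the same
    column changes the sign of the left-hand side and also preserves it. *)
Lemma csum_msym_rsum (w : 'S_n) :
  exists k, forall p, csum (msym w (rsum p)) = k *: ysym p.
Proof.
have [|Nex] := pselect (exists i j,
    [/\ i != j, ro i = ro j & co (w i) = co (w j)]).
  move=> [i [j [ij rij cij]]]; exists 0 => p; rewrite scale0r.
  apply: (@signed_tperm_eq0 _ _ _ (w i) (w j)).
  - by rewrite (inj_eq perm_inj).
  - exact: tperm_stab.
  - rewrite -msymMm -tpermJ conjgE !mulgA mulgV mul1g msymMm.
    by rewrite msym_plain // tperm_stab.
have [s [t [sr tc ->]]] : exists s t,
    [/\ s \in stab ro, t \in stab co & w = (s * t)%g].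
  apply: perm_row_column_factor diag _ _ => i j ij rij cij.
  by apply: Nex; exists i, j.
by exists ((-1) ^+ odd_perm t) => p; rewrite msymMm msym_plain // signed_msym.
Qed.

Lemma csum_act_rsum a :
  exists k, forall p, csum (act a (rsum p)) = k *: ysym p.
Proof.
have [k kP] := fin_all_exists csum_msym_rsum.
exists (\sum_w a w * k w) => p.
rewrite [act a _]/act linear_sum /= scaler_suml; apply: eq_bigr => w _.
by rewrite linearZ /= kP scalerA.
Qed.

(** Up to a constant that does not depend on [p], a group algebra element
    preserves the norm of [ysym p]; this reflects the irreducibility of the left
    ideal generated by the Young symmetrizer. *)
Lemma act_ysym_norm a :
  exists k, forall d p,
    form d (act a (ysym p)) (act a (ysym p)) = k * form d (ysym p) (ysym p).
Proof.
pose D := signed C (stab_group co).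
have [k kP] := csum_act_rsum (conv (star a) (conv a D)).
have N0 : #|stab_group co|%:R != 0 :> C by rewrite pnatr_eq0 -lt0n cardG_gt0.
exists (k^* / #|stab_group co|%:R) => d p.
have csumT x y : form d (csum x) y = form d x (csum y).
  by rewrite act_adjoint; congr (form _ _ _); apply/eq_act/star_signed.
have bE x : act (star a) (act a (csum x)) = act (conv (star a) (conv a D)) x.
  by rewrite (act_comp a) (act_comp (star a)).
have := kP p; rewrite /ysym; move: (rsum p) => x kx.
rewrite (act_adjoint d a) csumT bE kx formZr.
have -> : form d (csum x) (csum x) = #|stab_group co|%:R * form d x (csum x).
  by rewrite csumT signed_idem formZr rmorph_nat.
by rewrite mulrA mulfVK.
Qed.

(** Any linear relation between the translates of a nonzero [ysym p] holds
    between the translates of every [ysym q]. *)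
Lemma act_ysym_eq0 a p q :
  ysym p != 0 -> act a (ysym p) = 0 -> act a (ysym q) = 0.
Proof.
move=> p0 ap0; have [k kP] := act_ysym_norm a.
have [d dp] := form_neq0 p0.
have k0 : k = 0.
  apply/eqP; have := kP d p; rewrite ap0 /form big1 => [/esym/eqP|m _].
    by rewrite mulf_eq0 (negPf dp) orbF.
  by rewrite mcoeff0 mul0r.
by apply: form_eq0 => e; rewrite kP k0 mul0r.
Qed.

End Symmetrizer.

(** * Specht polynomials *)

Section Specht.
Variables (C : numClosedFieldType) (n : nat) (ro co : 'I_n -> nat).
Implicit Types (i j k : 'I_n).

Local Notation csum := (act (signed C (stab_group co))).
Local Notation column_pair :=
  (fun p : 'I_n * 'I_n => (co p.1 == co p.2) && (ro p.2 < ro p.1)%N).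

(** The Specht polynomial of the filling with rows [ro] and columns [co]. *)
Definition specht : {mpoly C[n]} :=
  \prod_(p | column_pair p) ('X_p.1 - 'X_p.2).

Lemma msymXU (s : 'S_n) i : msym s 'X_i = 'X_(s i) :> {mpoly C[n]}.
Proof. by rewrite /msym mmapX mmap1U. Qed.

Lemma mpolyXU_sub_eq0 i j : ('X_i - 'X_j == 0 :> {mpoly C[n]}) = (i == j).
Proof.
apply/eqP/eqP => [|->]; last by rewrite subrr.
move/(congr1 (mcoeff U_(i)%MM)); rewrite mcoeffB !mcoeffXU eqxx mcoeff0.
by move/eqP; rewrite subr_eq0; case: (j =P i) => // _; rewrite oner_eq0.
Qed.

Lemma specht_neq0 : specht != 0.
Proof.
apply/prodf_neq0 => -[i j] /= /andP[_ rij]; rewrite mpolyXU_sub_eq0.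
by apply: contraTneq rij => ->; rewrite ltnn.
Qed.

Hypothesis diag : diagram_coordinates ro co.

(** The product of all differences of two distinct entries of a column is, up to
    sign, the square of the Specht polynomial. *)
Lemma specht_sign s :
  s \in stab co -> msym s specht = specht \/ msym s specht = - specht.
Proof.
move=> sc; have coE i : co (s i) = co i by apply: (stabP _ _ sc).
pose P : {mpoly C[n]} :=
  \prod_(p : 'I_n * 'I_n | (co p.1 == co p.2) && (p.1 != p.2)) ('X_p.1 - 'X_p.2).
have PE : exists e, P = (-1) ^+ e * specht ^+ 2.
  exists #|[pred p | column_pair p]|.
  rewrite /P (bigID (fun p : 'I_n * 'I_n => ro p.2 < ro p.1)%N) /= expr2 mulrCA.
  rewrite [X in _ * X = _](reindex_inj
    (h := fun p : 'I_n * 'I_n => (p.2, p.1))) /=; last first.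
    by move=> [i j] [i' j'] /= [-> ->].
  congr (_ * _).
    apply: eq_bigl => -[i j] /=; rewrite andbAC.
    by apply/andb_idr => /andP[_]; apply: contraTneq => ->; rewrite ltnn.
  rewrite -prodrN; apply: eq_big => [[i j]|p _] /=; last by rewrite opprB.
  rewrite eq_sym -andbA; apply: andb_id2l => /eqP cij; rewrite -leqNgt leq_eqVlt.
  have [rij|] := eqVneq (ro j) (ro i).
    by rewrite (diag.1 _ _ rij (esym cij)) eqxx ltnn.
  rewrite /= => rij; apply: andb_idl => _.
  by apply: contraNneq rij => ->.
have Ps : msym s P = P.
  rewrite rmorph_prod /=.
  rewrite [RHS](reindex_inj (h := fun p : 'I_n * 'I_n => (s p.1, s p.2))) /=.
    apply: eq_big => [p|p _]; first by rewrite !coE (inj_eq perm_inj).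
    by rewrite rmorphB /= !msymXU.
  by move=> [i j] [i' j'] /= [/perm_inj-> /perm_inj->].
have [e Pe] := PE; move: Ps; rewrite Pe rmorphM rmorph_sign /=.
have s0 : (-1) ^+ e != 0 :> {mpoly C[n]} by rewrite signr_eq0.
move/(mulfI s0); rewrite rmorphXn /= => /eqP.
by rewrite eqf_sqr => /orP[]/eqP; [left|right].
Qed.

(** The sign for a transposition is found by dividing by the difference of the
    two exchanged variables, and then giving them the same value: the quotient
    does not vanish there, so that it cannot change its sign. *)
Lemma specht_tperm i j :
  i != j -> co i = co j -> msym (tperm i j) specht = - specht.
Proof.
wlog rij : i j / (ro i < ro j)%N.
  move=> H ij cij; have [rij|rji|rij] := ltngtP (ro i) (ro j); first by apply: H.
    by rewrite tpermC H // eq_sym.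
  by case/eqP: ij; apply: diag.1.
move=> ij cij; set t := tperm i j.
have [|//] := specht_sign (tperm_stab cij); rewrite -/t.
rewrite /specht (bigD1 (j, i)) /=; last by rewrite cij eqxx.
set h := \prod_(p | _) _; rewrite rmorphM rmorphB /= !msymXU tpermL tpermR.
rewrite -opprB mulNr => /eqP; rewrite eq_sym -addr_eq0 -mulrDr mulf_eq0.
rewrite mpolyXU_sub_eq0 eq_sym (negPf ij) /=.
(* The variable of each entry takes the value of its row, except that the
   variable [i] takes the same value as [j]. *)
pose f k := if k == i then j else k.
pose v k : C := (ro (f k))%:R.
have ft k : f (t k) = f k.
  rewrite /f; case: tpermP => [->|->|/eqP/negPf->];
    by rewrite ?eqxx 1?eq_sym ?(negPf ij).
move/eqP/(congr1 (meval v)); rewrite mevalD meval0.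
have -> : meval v (msym t h) = meval v h.
  rewrite /h rmorph_prod !rmorph_prod /=; apply: eq_bigr => p _.
  by rewrite rmorphB /= !msymXU !mevalB !mevalXU /v !ft.
move/eqP; rewrite -mulr2n mulrn_eq0 /= /h rmorph_prod /= => /prodf_eq0[[k l]] /=.
move=> /andP[/andP[/eqP ckl rlk] nkl]; rewrite mevalB !mevalXU subr_eq0 eqr_nat.
have cf m : co (f m) = co m by rewrite /f; case: eqP => [->|].
move=> /eqP/diag.1; rewrite !cf => /(_ ckl); rewrite /f.
have [ki|ki] := eqVneq k i; have [li|li] := eqVneq l i.
- by move: rlk; rewrite ki li ltnn.
- by move=> jl; move: rlk; rewrite ki -jl ltnNge ltnW.
- by move=> kj; move: nkl; rewrite kj li eqxx.
- by move=> kl; move: rlk; rewrite kl ltnn.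
Qed.

Lemma specht_antisym s :
  s \in stab co -> msym s specht = (-1) ^+ odd_perm s *: specht.
Proof.
move: s; apply: stab_ind => [|i j s ij cij _ IHs].
  by rewrite odd_perm1 scale1r msym1m.
rewrite msymMm IHs msymZ specht_tperm // odd_permM odd_tperm ij signr_addb.
by rewrite expr1 mulrN1 scaleNr scalerN.
Qed.

(** The degree of the Specht polynomial in the variable [k] is the number of the
    other entries in the column of [k]. *)
Lemma msupp_specht_lt (m : 'X_{1..n}) k :
  m \in msupp specht -> (m k < height co (co k))%N.
Proof.
pose d (p : 'I_n * 'I_n) := ((p.1 == k) + (p.2 == k))%N.
have md : m \in msupp specht -> (m k <= \sum_(p | column_pair p) d p)%N.
  move: m; rewrite /specht.
  elim/big_ind2: _ => [m|x1 x2 y1 y2 IH1 IH2 m|p _ m].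
  - by rewrite msupp1 inE => /eqP->; rewrite mnm0E.
  - move/msuppM_le/allpairsP => -[[m1 m2] /= [/IH1 h1 /IH2 h2 ->]].
    by rewrite mnmDE leq_add.
  - move/msuppB_le; rewrite mem_cat !msuppX !inE => /orP[]/eqP->;
    by rewrite mnm1E /d ?leq_addr ?leq_addl.
move/md/leq_ltn_trans; apply.
have -> : (\sum_(p | column_pair p) d p =
    \sum_l (column_pair (k, l) + column_pair (l, k)))%N.
  rewrite big_split [RHS]big_split /=; congr (_ + _)%N.
    rewrite -(pair_big_dep xpredT (fun x y => column_pair (x, y))
      (fun x y => x == k : nat)) /=.
    rewrite (bigD1 k) //= [X in (_ + X)%N]big1 ?addn0 => [|x /negPf->]; last first.
      by rewrite big1.
    by rewrite big_mkcond /=; apply: eq_bigr => l _; rewrite eqxx; case: ifP.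
  rewrite -(pair_big_dep xpredT (fun x y => column_pair (x, y))
      (fun x y => y == k : nat)) /= (exchange_big_dep xpredT) //=.
  rewrite (bigD1 k) //= [X in (_ + X)%N]big1 ?addn0 => [|x /negPf->]; last first.
    by rewrite big1.
  by rewrite big_mkcond /=; apply: eq_bigr => l _; rewrite eqxx; case: ifP.
rewrite /height (cardsD1 k) inE eqxx add1n ltnS -sum1_card [leqRHS]big_mkcond /=.
apply: leq_sum => l _; rewrite !inE [co l == _]eq_sym.
have [->|lk] := eqVneq l k; first by rewrite ltnn andbF.
by rewrite [co k == _]eq_sym; case: eqP => // _; case: ltngtP.
Qed.

(** The monomial in which the exponent of each entry is its row. *)
Definition row_monomial : {mpoly C[n]} := 'X_[[multinom ro i | i < n]].

(** If two exponents in a column are equal, then the signed sum vanishes;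
    otherwise the exponents in each column are a permutation of the rows. *)
Lemma csum_monomial (m : 'X_{1..n}) :
    (forall k, (m k < height co (co k))%N) ->
  exists e, csum 'X_[m] = e *: csum row_monomial.
Proof.
move=> mlt; have [[i [j [ij cij mij]]]|Nex] := pselect (exists i j,
    [/\ i != j, co i = co j & m i = m j]).
  exists 0; rewrite scale0r; apply: (signed_tperm_eq0 ij).
    exact: tperm_stab.
  rewrite msymX; congr 'X_[_]; apply/mnmP => k; rewrite mnmE tpermV.
  by case: tpermP => [->|->|].
have ex k : exists l, ro l = m k /\ co l = co k.
  by have [l rl cl] := height_exists diag (mlt k); exists l.
have [f fP] := fin_all_exists ex.
have finj : injective f.
  move=> i j fij; apply: contrapT => /eqP ij; apply: Nex; exists i, j.
  by have [[ri ci] [rj cj]] := (fP i, fP j); rewrite -ri -ci fij.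
have sc : ((perm finj)^-1)%g \in stab_group co.
  by rewrite groupV; apply/stabP => k; rewrite permE (fP k).2.
exists ((-1) ^+ odd_perm (perm finj)^-1); rewrite -signed_msym // msymX invgK.
congr (csum 'X_[_]); apply/mnmP => k.
by rewrite !mnmE permE (fP k).1.
Qed.

(** The signed sum multiplies the Specht polynomial by the order of the column
    group, and maps each of its monomials to a multiple of one polynomial. *)
Lemma specht_eq_csum : exists e, specht = e *: csum row_monomial.
Proof.
have N0 : #|stab_group co|%:R != 0 :> C by rewrite pnatr_eq0 -lt0n cardG_gt0.
have := act_signed_antisym specht_antisym.
have ex (m : 'X_{1..n}) : exists e, m \in msupp specht ->
    csum 'X_[m] = e *: csum row_monomial.
  have [mg|_] := boolP (m \in msupp specht); last by exists 0.
  have [|e eE] := @csum_monomial m; last by exists e.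
  by move=> k; apply: msupp_specht_lt.
have [e eP] := choice ex.
rewrite {1}[specht]mpolyE linear_sum /=.
rewrite (eq_big_seq (fun m => (specht@_m * e m) *: csum row_monomial)) /=; last first.
  by move=> m mg; rewrite linearZ /= eP // scalerA.
rewrite -scaler_suml => /(congr1 (fun p => #|stab_group co|%:R^-1 *: p)).
rewrite scalerA [RHS]scalerA mulVf // scale1r => <-.
by exists (#|stab_group co|%:R^-1 * \sum_(m <- msupp specht) specht@_m * e m).
Qed.

(** Hence the Specht polynomial is in the image of the Young symmetrizer. *)
Lemma specht_eq_ysym : exists q, specht = ysym ro co q.
Proof.
have [e eE] := specht_eq_csum.
have N0 : #|stab_group ro|%:R != 0 :> C by rewrite pnatr_eq0 -lt0n cardG_gt0.
exists (e / #|stab_group ro|%:R *: row_monomial).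
rewrite eE /ysym !linearZ /= act_plainE (eq_bigr (fun=> row_monomial)).
  by rewrite sumr_const -scaler_nat linearZ /= scalerA divfK.
move=> s sr; rewrite msymX; congr 'X_[_]; apply/mnmP => k; rewrite !mnmE.
by apply: (stabP ro s^-1%g _); rewrite groupV.
Qed.

End Specht.

(** * Straightening *)

Section Straightening.
Variables (C : numClosedFieldType) (n : nat) (ro co : 'I_n -> nat).
Hypothesis diag : diagram_coordinates ro co.
Implicit Types (i j k : 'I_n) (s w : 'S_n).

Local Notation csum := (act (signed C (stab_group co))).
Local Notation g := (specht C ro co).

(** For [i] and [j] in the same row with [i] to the left of [j], the Garnir set
    consists of the entries above [i] in its column, of those below [j] in its
    column, and of [i] and [j]. *)
Definition garnir_set i j : {set 'I_n} :=
  ([set k | (co k == co i) && (ro i <= ro k)%N] :|: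
   [set k | (co k == co j) && (ro k < (ro i).+1)%N])%SET.

(** The label of the entries in the Garnir set is [0], and those of the other
    entries are distinct and positive, so that the stabilizer of this labelling
    is the symmetric group of the Garnir set. *)
Definition garnir_label i j k : nat :=
  if k \in garnir_set i j then 0%N else k.+1.

Lemma garnir_label_fix i j s k :
  s \in stab (garnir_label i j) -> k \notin garnir_set i j -> s k = k.
Proof.
move=> /stabP/(_ k); rewrite /garnir_label => + /negPf kN; rewrite kN.
by case: ifP => // _ [sk]; apply/val_inj.
Qed.

Lemma garnir_label_mem i j s k :
  s \in stab (garnir_label i j) -> (s k \in garnir_set i j) = (k \in garnir_set i j).
Proof.
by move=> /stabP/(_ k); rewrite /garnir_label; do 2!case: ifP => //.
Qed.

Lemma card_garnir_set i j :
    ro i = ro j -> (co i < co j)%N ->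
  (height co (co i) < #|garnir_set i j|)%N.
Proof.
move=> rij cij; rewrite /garnir_set cardsU.
set B := [set k | (co k == co j) && _]%SET; set A := [set k | _]%SET.
have -> : (A :&: B = finset.set0)%SET.
  apply/finset.setP => k; rewrite !inE; apply/negP.
  by move=> /andP[/andP[/eqP-> _] /andP[/eqP cji _]]; rewrite cji ltnn in cij.
rewrite cards0 subn0 {}/B {}/A.
rewrite (card_column diag) (minn_idPl _); last by rewrite rij ltn_height.
rewrite addnS ltnS -[leqRHS]addnC -{1}(minn_idPl (ltnW (ltn_height diag i))).
rewrite -(card_column diag) -leq_subLR /height -cardsDS.
  apply: subset_leq_card; apply/fintype.subsetP => k; rewrite !inE.
  by case: eqP => //=; rewrite -leqNgt andbT.
by apply/fintype.subsetP => k; rewrite !inE => /andP[].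
Qed.

(** The Garnir relation: in each monomial of the Specht polynomial the exponents
    of the entries of the Garnir set are less than the height of the left column,
    so that two of them are equal. *)
Lemma garnir_relation i j :
    ro i = ro j -> (co i < co j)%N ->
  act (signed C (stab_group (garnir_label i j))) g = 0.
Proof.
move=> rij cij; have [e ->] := specht_eq_csum C diag.
rewrite linearZ /= (act_signedE (stab_group co)).
rewrite (linear_sum (act (signed C (stab_group (garnir_label i j))))) /=.
rewrite big1 ?scaler0 // => s sc.
rewrite linearZ /= /row_monomial msymX.
set m := [multinom _ | _ < _]%MM.
have [k [l [Gk Gl kl mkl]]] : exists k l,
    [/\ k \in garnir_set i j, l \in garnir_set i j, k != l & m k = m l].
  apply: contrapT => Nex; have := card_garnir_set rij cij.
  apply/negP; rewrite -leqNgt; apply: (card_inj_le (f := m)) => [k l Gk Gl mkl|k].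
    by apply: contrapT => /eqP kl; apply: Nex; exists k, l.
  have coE : co (s^-1 k)%g = co k.
    by apply: (stabP co s^-1%g _); rewrite groupV.
  rewrite /m !mnmE => Gk; apply: leq_trans (ltn_height diag _) _; rewrite coE.
  move: Gk; rewrite !inE => /orP[]/andP[/eqP-> _] //.
  exact: (leq_height diag (ltnW cij)).
rewrite (signed_tperm_eq0 kl) ?scaler0 //.
  by apply: tperm_stab; rewrite /garnir_label Gk Gl.
rewrite msymX; congr 'X_[_]; apply/mnmP => x; rewrite mnmE tpermV.
by case: tpermP => [->|->|].
Qed.

(** The tableau obtained by applying w to the entries is standard. *)
Definition standard w : Prop :=
  (forall i j, ro i = ro j -> (co i < co j)%N -> (w i < w j)%N) /\
  (forall i j, co i = co j -> (ro i < ro j)%N -> (w i < w j)%N).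

(** The linear combinations of the translates of the Specht polynomial by
    standard tableaux. *)
Definition standard_comb p : Prop :=
  exists2 a : 'S_n -> C, (forall w, a w != 0 -> standard w) & p = act a g.

Lemma standard_combD p q :
  standard_comb p -> standard_comb q -> standard_comb (p + q).
Proof.
move=> [a aS ->] [b bS ->]; exists (fun s => 1 * a s + b s); last first.
  by rewrite actDl scale1r.
move=> w; rewrite mul1r; have [->|/aS//] := eqVneq (a w) 0.
by rewrite add0r; apply: bS.
Qed.

Lemma standard_combZ c p : standard_comb p -> standard_comb (c *: p).
Proof.
move=> [a aS ->]; exists (fun s => c * a s + 0); last first.
  by rewrite (actDl a (fun=> 0)) [X in _ + X]big1 ?addr0 // => s _; rewrite scale0r.
by move=> w; rewrite addr0 mulf_eq0 negb_or => /andP[_ /aS].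
Qed.

Lemma standard_comb0 : standard_comb 0.
Proof.
exists (fun=> 0) => [w|]; first by rewrite eqxx.
by rewrite /act big1 // => s _; rewrite scale0r.
Qed.

Lemma standard_comb_msym w : standard w -> standard_comb (msym w g).
Proof.
move=> wS; exists (fun s => (s == w)%:R); last by rewrite act_delta.
by move=> s; case: (s =P w) => [->|]; rewrite ?eqxx.
Qed.

(** Both weights of the translated tableau are sums over its boxes of the entry
    times the index of the column, respectively of the row. *)
Definition col_weight w : nat := (\sum_k co k * w k)%N.
Definition row_weight w : nat := (\sum_k ro k * w k)%N.

Lemma row_weight_tperm w i j :
    (ro i < ro j)%N -> (w j < w i)%N ->
  (row_weight w < row_weight (tperm i j * w)%g)%N.
Proof.
move=> rij wij; have ji : j != i by apply: contraTneq rij => ->; rewrite ltnn.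
rewrite /row_weight (bigD1 i) // (bigD1 j) //=.
rewrite [ltnRHS](bigD1 i) // [X in (_ < _ + X)%N](bigD1 j) //=.
rewrite !permM tpermL tpermR !addnA.
set x := (\sum_(k | _) _)%N; set y := (\sum_(k | _) _)%N.
have -> : x = y.
  by apply: eq_bigr => k /andP[ki kj]; rewrite permM tpermD // eq_sym.
rewrite ltn_add2r; nia.
Qed.

Lemma col_weight_tperm w i j :
  co i = co j -> col_weight (tperm i j * w)%g = col_weight w.
Proof.
move=> cij; rewrite /col_weight [RHS](reindex_inj (@perm_inj _ (tperm i j))) /=.
by apply: eq_bigr => k _; rewrite permM (stabP co _ (tperm_stab cij)).
Qed.

(** If the columns are increasing and the entries of [i] and [j] are in the
    wrong order, then each entry of the Garnir set in the left column is larger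
    than each of those in the right column, so that moving one of them to the
    other column increases the column weight. *)
Lemma col_weight_garnir w i j s :
    (forall k l, co k = co l -> (ro k < ro l)%N -> (w k < w l)%N) ->
    ro i = ro j -> (co i < co j)%N -> (w j < w i)%N ->
    s \in stab (garnir_label i j) -> s \notin stab co ->
  (col_weight w < col_weight (s * w)%g)%N.
Proof.
move=> wcol rij cij wji sG sNc.
have le_col k l : co k = co l -> (ro k <= ro l)%N -> (w k <= w l)%N.
  move=> ckl; rewrite leq_eqVlt => /orP[/eqP rkl|/(wcol _ _ ckl)/ltnW//].
  by rewrite (diag.1 _ _ rkl ckl).
have coE : col_weight (s * w)%g = (\sum_k co (s^-1 k)%g * w k)%N.
  rewrite [RHS](reindex_inj (@perm_inj _ s)).
  by apply: eq_bigr => k _; rewrite permM permK.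
(* Both weights are compared after subtracting the mean value of the entries of
   [i] and [j], which makes each term of the difference nonnegative. *)
pose d k : int := (co (s^-1 k)%g)%:Z - (co k)%:Z.
pose e k : int := (w k)%:Z *+ 2 - (w i)%:Z - (w j)%:Z.
have sum_d : \sum_k d k = 0.
  rewrite sumrB [X in _ - X](reindex_inj (@perm_inj _ s^-1%g)) /=.
  by rewrite subrr.
have key : ((col_weight (s * w)%g)%:Z - (col_weight w)%:Z) *+ 2 = \sum_k d k * e k.
  transitivity (\sum_k (d k * (w k)%:Z) *+ 2 - (\sum_k d k) * ((w i)%:Z + (w j)%:Z)).
    rewrite sum_d mul0r subr0 sumrMnl; congr (_ *+ _).
    rewrite coE /col_weight !(big_morph Posz PoszD (erefl _)) -sumrB.
    by apply: eq_bigr => k _; rewrite !PoszM -mulrBl.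
  rewrite mulr_suml -sumrB; apply: eq_bigr => k _.
  by rewrite /e -[in RHS]addrA -opprD mulrBr mulrnAr.
have sVG : s^-1%g \in stab (garnir_label i j) by rewrite groupV.
have term k : d k != 0 -> 0 < d k * e k.
  have [Gk|/(garnir_label_fix sVG) sk] := boolP (k \in garnir_set i j); last first.
    by rewrite /d sk subrr eqxx.
  have := Gk; rewrite -(garnir_label_mem k sVG).
  have cG l : l \in garnir_set i j -> co l = co i \/ co l = co j.
    by rewrite !inE => /orP[]/andP[/eqP-> _]; [left|right].
  move=> /cG cs dk; move: Gk; rewrite !inE => /orP[]/andP[/eqP ck rk].
    have wk : (w i <= w k)%N by apply: le_col.
    have ck' : co (s^-1 k)%g = co j.
      by case: cs => // cs; move: dk; rewrite /d cs ck subrr eqxx.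
    by rewrite mulr_gt0 // /d /e ?ck ?ck'; lia.
  have wk : (w k <= w j)%N by apply: le_col; rewrite // -rij -ltnS.
  have ck' : co (s^-1 k)%g = co i.
    by case: cs => // cs; move: dk; rewrite /d cs ck subrr eqxx.
  by rewrite nmulr_rgt0 /d /e ?ck ?ck'; lia.
have [k0 dk0] : exists k, d k != 0.
  apply: contrapT => Nd; move/negP: sNc; apply; apply/stabP => k.
  apply/eqP/negPn/negP => ck; apply: Nd; exists (s k).
  by rewrite /d permK subr_eq0 eqz_nat eq_sym.
have : 0 < \sum_k d k * e k.
  rewrite (bigD1 k0) //= ltr_wpDr ?term // sumr_ge0 // => k _.
  by have [->|/term/ltW//] := eqVneq (d k) 0; rewrite mul0r.
rewrite -key pmulrn_lgt0 // subr_gt0; lia.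
Qed.

(** Translates of the Specht polynomial by standard tableaux span the Specht
    module.  The induction is on the lexicographic order of the two weights:
    exchanging two entries of a column keeps the column weight and increases the
    row weight, and the Garnir relation increases the column weight. *)
Lemma specht_straightening w : standard_comb (msym w g).
Proof.
pose gt (u v : 'S_n) := (col_weight v < col_weight u)%N ||
  (col_weight v == col_weight u) && (row_weight v < row_weight u)%N.
have gt_trans u v x : gt u v -> gt v x -> gt u x.
  rewrite /gt; lia.
have [m] := ubnP #|[set u | gt u w]%SET|; elim: m w => // m IHm w.
rewrite ltnS => wm.
have IH u : gt u w -> standard_comb (msym u g).
  move=> uw; apply: IHm; apply: leq_trans wm; apply: proper_card.
  apply/properP; split; last first.
    by exists u; rewrite !inE // /gt !ltnn eqxx.
  by apply/fintype.subsetP => v; rewrite !inE => /gt_trans; apply.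
have [wcol|/existsNP[i /existsNP[j]]] := pselect
    (forall i j, co i = co j -> (ro i < ro j)%N -> (w i < w j)%N); last first.
  move=> /not_implyP[cij /not_implyP[rij /negP]]; rewrite -leqNgt leq_eqVlt.
  have ij : i != j by apply: contraTneq rij => ->; rewrite ltnn.
  rewrite val_eqE (inj_eq perm_inj) eq_sym (negPf ij) /= => wij.
  have -> : msym w g = - 1 *: msym (tperm i j * w)%g g.
    by rewrite msymMm specht_tperm // msymN scalerN scaleN1r opprK.
  apply/standard_combZ/IH; rewrite /gt col_weight_tperm // ltnn eqxx /=.
  exact: row_weight_tperm.
have [wrow|/existsNP[i /existsNP[j]]] := pselect
    (forall i j, ro i = ro j -> (co i < co j)%N -> (w i < w j)%N).
  exact: standard_comb_msym.
move=> /not_implyP[rij /not_implyP[cij /negP]]; rewrite -leqNgt leq_eqVlt.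
have ij : i != j by apply: contraTneq cij => ->; rewrite ltnn.
rewrite val_eqE (inj_eq perm_inj) eq_sym (negPf ij) /= => wij.
have := congr1 (msym w) (garnir_relation rij cij).
rewrite msym0 act_signedE linear_sum (bigID (mem (stab co))) /=.
rewrite (eq_bigr (fun=> msym w g)); last first.
  move=> s /andP[_ sc]; rewrite specht_antisym // scalerA -signr_addb addbb.
  by rewrite scale1r.
(* The terms of the Garnir relation from the column group are all equal to the
   translate by w, so that it can be expressed by the other terms. *)
rewrite sumr_const -scaler_nat => /eqP; rewrite addr_eq0 => /eqP.
set N := #|_|; have N0 : N%:R != 0 :> C.
  rewrite pnatr_eq0 -lt0n; apply/card_gt0P; exists 1%g.
  by apply/andP; split; apply: (group1 (stab_group _)).
move/(congr1 (fun p => N%:R^-1 *: p)); rewrite scalerA mulVf // scale1r => ->.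
apply/standard_combZ; rewrite -scaleN1r; apply/standard_combZ.
apply: big_ind => [||s /andP[sG sNc]].
- exact: standard_comb0.
- exact: standard_combD.
rewrite msymZ -msymMm; apply/standard_combZ/IH; rewrite /gt.
by rewrite (col_weight_garnir wcol rij cij wij sG sNc).
Qed.

End Straightening.

(** * Modules generated by one polynomial *)

Section CyclicModules.
Variables (C : numClosedFieldType) (n : nat).
Implicit Types (p q F G : {mpoly C[n]}) (a b : 'S_n -> C) (s w : 'S_n).

Lemma actBl a b p : act (fun s => -1 * b s + a s) p = act a p - act b p.
Proof. by rewrite actDl scaleN1r addrC. Qed.

(** The span of some translates of [F] that include [F] itself. *)
Lemma mpoly_span_translates (P : 'S_n -> Prop) (U : set {mpoly C[n]}) F :
    P 1%g -> (forall p, U p <-> exists2 w, P w & p = msym w F) ->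
  forall p, mpoly_span U p <->
    exists2 a : 'S_n -> C, (forall w, a w != 0 -> P w) & p = act a F.
Proof.
move=> P1 UP p; split=> [[m [c [u [Uu ->]]]]|[a aP ->]].
  have [w wP] : exists w : 'I_m -> 'S_n, forall i, P (w i) /\ u i = msym (w i) F.
    apply: (@fin_all_exists _ _ (fun i w => P w /\ u i = msym w F)) => i.
    by have [w Pw uE] := (UP _).1 (Uu i); exists w.
  exists (fun s => \sum_i c i * (s == w i)%:R).
    move=> s /eqP as0; apply: contrapT => Ps; apply: as0; rewrite big1 // => i _.
    case: (s =P w i) => [sw|_]; last by rewrite mulr0.
    by case: Ps; rewrite sw; apply: (wP i).1.
  rewrite /act; under [RHS]eq_bigr do rewrite scaler_suml.
  rewrite [RHS]exchange_big; apply: eq_bigr => i _ /=.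
  rewrite (wP i).2 -[in LHS](act_delta (w i)) /act scaler_sumr.
  by apply: eq_bigr => s _; rewrite scalerA.
(* The permutations that do not satisfy P have coefficient zero; their terms are
   replaced by [F], which is in [U]. *)
pose v (w : 'S_n) := if `[< P w >] then msym w F else F.
exists #|[set: 'S_n]%SET|, (fun i => a (enum_val i)), (fun i => v (enum_val i)).
split=> [i|].
  apply/UP; rewrite /v; case: asboolP => Pw; first by exists (enum_val i).
  by exists 1%g; rewrite ?msym1m.
rewrite -(big_enum_val (fun w => a w *: v w)) /=.
apply: eq_big => [w|w _]; first by rewrite inE.
rewrite /v; case: asboolP => // Pw; suff -> : a w = 0 by rewrite !scale0r.
by apply/eqP/negPn/negP => /aP.
Qed.

(** The cyclic module generated by [F] is a submodule. *)
Lemma cyclic_submodule (V : set {mpoly C[n]}) F :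
  (forall p, V p <-> exists a, p = act a F) -> Sn_submodule V.
Proof.
move=> VP; split=> [|c p q /VP[a ->] /VP[b ->]|s p /VP[a ->]]; apply/VP.
- by exists (fun=> 0); rewrite /act big1 // => s _; rewrite scale0r.
- by exists (fun s => c * a s + b s); rewrite actDl.
- by exists (fun t => a (t * s^-1)%g); rewrite msym_act.
Qed.

(** If [F] and [G] have the same annihilator in the group algebra, then mapping
    [act a F] to [act a G] is well defined and one-to-one. *)
Lemma cyclic_isomorphic (V W : set {mpoly C[n]}) F G :
    (forall p, V p <-> exists a, p = act a F) ->
    (forall p, W p <-> exists a, p = act a G) ->
    (forall a, act a F = 0 <-> act a G = 0) ->
  Sn_isomorphic V W.
Proof.
move=> VP WP FG.
have eqFG a b : act a F = act b F <-> act a G = act b G.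
  split=> /eqP; rewrite -subr_eq0 -actBl => /eqP/FG/eqP;
  by rewrite actBl subr_eq0 => /eqP.
pose f p := if pselect (exists a, p = act a F) is left e
  then act (projT1 (cid e)) G else 0.
have fE a : f (act a F) = act a G.
  rewrite /f; case: pselect => [e|[]]; last by exists a.
  by case: cid => b /= /esym/eqFG.
exists f; split=> [c p q /VP[a ->] /VP[b ->]|s p /VP[a ->]|].
- by rewrite -actDl !fE actDl.
- by rewrite msym_act !fE msym_act.
split=> [p /VP[a ->]|p q|p /WP[a ->]].
- by apply/WP; exists a; rewrite fE.
- by rewrite !inE => /VP[a ->] /VP[b ->]; rewrite !fE => /eqFG.
- by exists (act a F); [apply/VP; exists a | rewrite fE].
Qed.

End CyclicModules.

(** * Change of filling *)

(** Below, [ro'] and [co'] are the rows and the columns of the entries after w has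
    been applied to the entries of the filling with rows [ro] and columns [co]. *)
Section Translation.
Variables (C : numClosedFieldType) (n : nat) (ro co ro' co' : 'I_n -> nat).
Variable w : 'S_n.
Hypotheses (row_w : forall i, ro' (w i) = ro i) (col_w : forall i, co' (w i) = co i).

Lemma stab_conj (f f' : 'I_n -> nat) (s : 'S_n) :
  (forall i, f' (w i) = f i) -> ((s ^ w)%g \in stab f') = (s \in stab f).
Proof.
move=> fw; apply/stabP/stabP => h i.
  by have := h (w i); rewrite conjgE !permM permK !fw.
by rewrite conjgE !permM fw h -fw permKV.
Qed.

Lemma act_conj (a a' : 'S_n -> C) p :
  (forall s, a' (s ^ w)%g = a s) -> act a' (msym w p) = msym w (act a p).
Proof.
move=> aw; rewrite act_msym msym_act; apply: eq_act => s.
by rewrite -(aw (s * w^-1)%g) conjgE -!mulgA mulVg mulg1.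
Qed.

Lemma msym_ysym (p : {mpoly C[n]}) :
  msym w (ysym ro co p) = ysym ro' co' (msym w p).
Proof.
rewrite /ysym (act_conj (a := plain C (stab_group ro))); last first.
  by move=> s; rewrite /plain /= (stab_conj s row_w).
rewrite (act_conj (a := signed C (stab_group co))) //.
by move=> s; rewrite /signed /= (stab_conj s col_w) odd_permJ.
Qed.

Lemma msym_specht : msym w (specht C ro co) = specht C ro' co'.
Proof.
rewrite /specht rmorph_prod /=.
rewrite [RHS](reindex_inj (h := fun p : 'I_n * 'I_n => (w p.1, w p.2))) /=.
  apply: eq_big => [p|p _]; first by rewrite !row_w !col_w.
  by rewrite rmorphB /= !msymXU.
by move=> [i j] [i' j'] /= [/perm_inj-> /perm_inj->].
Qed.

End Translation.

(** * Fillings of Young diagrams *)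

Section Fillings.
Variables (C : numClosedFieldType) (n : nat) (la : seq nat).
Hypothesis la_part : is_partition n la.
Implicit Types (T : filling n la) (b : box la) (i : 'I_n).

Lemma leq_nth_partition r r' :
  (r <= r')%N -> (nth 0%N la r' <= nth 0%N la r)%N.
Proof.
move=> rr'; have [sla _ _] := and3P la_part.
have [lr'|r'la] := leqP (size la) r'; first by rewrite nth_default.
apply: (sorted_leq_nth _ _ 0%N sla) => //; last exact: leq_ltn_trans r'la.
- by move=> x y z /= yx zx; apply: leq_trans zx yx.
- by move=> x /=.
Qed.

Lemma bcol_lt b : (bcol b < head 0%N la)%N.
Proof.
case: b => i j; rewrite /bcol /= -nth0.
exact: leq_trans (ltn_ord j) (leq_nth_partition (leq0n i)).
Qed.

Lemma box_inj b b' : brow b = brow b' -> bcol b = bcol b' -> b = b'.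
Proof.
case: b b' => i j [i' j']; rewrite /brow /bcol /= => /val_inj ii'.
by case: _ / ii' in j' * => /val_inj->.
Qed.

Lemma box_down b r c :
  (r <= brow b)%N -> (c <= bcol b)%N ->
  exists2 b' : box la, brow b' = r & bcol b' = c.
Proof.
case: b => i j; rewrite /brow /bcol /= => ri cj.
have rla : (r < size la)%N := leq_ltn_trans ri (ltn_ord i).
have clt : (c < nth 0%N la (Ordinal rla))%N.
  exact: leq_trans (leq_ltn_trans cj (ltn_ord j)) (leq_nth_partition ri).
by exists (Tagged (fun i : 'I_(size la) => 'I_(nth 0%N la i)) (Ordinal clt)).
Qed.

(** The row and the column of the entry [i] of T; the default value [0] is never
    used when T is bijective. *)
Definition entry_row T i : nat := oapp (@brow la) 0%N [pick b | T b == i].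
Definition entry_col T i : nat := oapp (@bcol la) 0%N [pick b | T b == i].

Section Entries.
Variable T : filling n la.
Hypothesis T_bij : bijective T.

Lemma entry_rowE b : entry_row T (T b) = brow b.
Proof.
rewrite /entry_row; case: pickP => [b' /eqP/(bij_inj T_bij)->//|/(_ b)].
by rewrite eqxx.
Qed.

Lemma entry_colE b : entry_col T (T b) = bcol b.
Proof.
rewrite /entry_col; case: pickP => [b' /eqP/(bij_inj T_bij)->//|/(_ b)].
by rewrite eqxx.
Qed.

Lemma entry_ex i : exists b, i = T b.
Proof. by have [T' _ T'K] := T_bij; exists (T' i). Qed.

Lemma filling_coordinates : diagram_coordinates (entry_row T) (entry_col T).
Proof.
split=> [i j|i r c]; have [b ->] := entry_ex i.
  have [b' ->] := entry_ex j; rewrite !entry_rowE !entry_colE => rb cb.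
  by rewrite (box_inj rb cb).
rewrite entry_rowE entry_colE => rb cb; have [b' rb' cb'] := box_down rb cb.
by exists (T b'); rewrite ?entry_rowE ?entry_colE.
Qed.

Lemma mem_row_entries r i : (i \in row_entries T r) = (entry_row T i == r).
Proof.
have [b ->] := entry_ex i; rewrite entry_rowE.
by rewrite /row_entries (mem_imset _ _ (bij_inj T_bij)) inE.
Qed.

Lemma mem_col_entries c i : (i \in col_entries T c) = (entry_col T i == c).
Proof.
have [b ->] := entry_ex i; rewrite entry_colE.
by rewrite /col_entries (mem_imset _ _ (bij_inj T_bij)) inE.
Qed.

(** A permutation preserves a family of sets that are the fibres of a labelling
    if and only if it preserves the labelling. *)
Lemma fibres_stab B (f : 'I_n -> nat) (E : nat -> {set 'I_n}) (s : 'S_n) :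
    (forall i, (f i < B)%N) -> (forall r i, (i \in E r) = (f i == r)) ->
  [forall r : 'I_B, [set s i | i in E r]%SET == E r] = (s \in stab f).
Proof.
move=> fB EP; apply/forallP/stabP => [h i|h r].
  have := EP (f i) (s i); rewrite -(eqP (h (Ordinal (fB i)))) /=.
  by rewrite (mem_imset _ _ perm_inj) EP eqxx => /esym/eqP.
rewrite eqEcard card_imset ?leqnn ?andbT; last exact: perm_inj.
by apply/fintype.subsetP => k /imsetP[x]; rewrite !EP => /eqP <- ->; rewrite h.
Qed.

Lemma row_groupE : row_group T = stab (entry_row T).
Proof.
apply/finset.setP => s; rewrite inE; apply: fibres_stab mem_row_entries => i.
by have [b ->] := entry_ex i; rewrite entry_rowE /brow.
Qed.

Lemma col_groupE : col_group T = stab (entry_col T).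
Proof.
apply/finset.setP => s; rewrite inE; apply: fibres_stab mem_col_entries => i.
by have [b ->] := entry_ex i; rewrite entry_colE bcol_lt.
Qed.

Lemma young_symmetrizerE (p : {mpoly C[n]}) :
  young_symmetrizer T p = ysym (entry_row T) (entry_col T) p.
Proof.
rewrite /young_symmetrizer /ysym act_signedE act_plainE row_groupE col_groupE.
by apply: eq_bigr => t _; rewrite -scaler_sumr (linear_sum (msym t)) /=.
Qed.

Lemma specht_polynomialE :
  specht_polynomial C T = specht C (entry_row T) (entry_col T).
Proof.
rewrite /specht [RHS](reindex (fun p : box la * box la => (T p.1, T p.2))) /=.
  rewrite (partition_big (fun p : box la * box la => Ordinal (bcol_lt p.1))
    xpredT) //=.
  apply: eq_bigr => c _; apply: eq_bigl => -[b b'] /=.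
  rewrite !entry_rowE !entry_colE -val_eqE /= [RHS]andbC.
  by case: (bcol b =P c) => //= <-; rewrite [bcol b' == _]eq_sym.
have [T' TK T'K] := T_bij.
by exists (fun p => (T' p.1, T' p.2)) => -[x y] _ /=; rewrite ?TK ?T'K.
Qed.

(** The filling obtained from T by applying w to the entries. *)
Definition translate (w : 'S_n) : filling n la := [ffun b => w (T b)].

Lemma translate_bij w : bijective (translate w).
Proof.
have [T' TK T'K] := T_bij.
exists (fun i => T' (w^-1%g i)) => [b|i]; first by rewrite ffunE permK TK.
by rewrite ffunE T'K permKV.
Qed.

Lemma translate_ex (T' : filling n la) :
  bijective T' -> exists w, T' = translate w.
Proof.
move=> T'_bij; have [U TK UK] := T_bij.
have inj : injective (fun i => T' (U i)).
  by move=> i j /(bij_inj T'_bij)/(can_inj UK).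
by exists (perm inj); apply/ffunP => b; rewrite ffunE permE TK.
Qed.

End Entries.

Lemma entry_row_translate T w i : bijective T ->
  entry_row (translate T w) (w i) = entry_row T i.
Proof.
move=> Tb; have [b ->] := entry_ex Tb i.
by rewrite entry_rowE // -(entry_rowE (translate_bij Tb w)) ffunE.
Qed.

Lemma entry_col_translate T w i : bijective T ->
  entry_col (translate T w) (w i) = entry_col T i.
Proof.
move=> Tb; have [b ->] := entry_ex Tb i.
by rewrite entry_colE // -(entry_colE (translate_bij Tb w)) ffunE.
Qed.

Lemma specht_F_translate (S : box la -> nat) T w : bijective T ->
  specht_F C S (translate T w) = msym w (specht_F C S T).
Proof.
move=> Tb; have Tb' := translate_bij Tb w.
rewrite /specht_F !young_symmetrizerE //.
rewrite (msym_ysym (fun i => entry_row_translate w i Tb)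
  (fun i => entry_col_translate w i Tb)); congr ysym.
rewrite /filling_monomial rmorph_prod; apply: eq_bigr => b _.
by rewrite rmorphXn /= msymXU ffunE.
Qed.

Lemma specht_polynomial_translate T w : bijective T ->
  specht_polynomial C (translate T w) = msym w (specht_polynomial C T).
Proof.
move=> Tb; have Tb' := translate_bij Tb w.
rewrite !specht_polynomialE //; apply/esym/msym_specht => i.
  exact: entry_row_translate.
exact: entry_col_translate.
Qed.

Lemma SYT_translate T w : bijective T ->
  @SYT n la (translate T w) <-> standard (entry_row T) (entry_col T) w.
Proof.
move=> Tb; split=> [[_ Trow Tcol]|[wrow wcol]].
  split=> i j; have [[b ->] [b' ->]] := (entry_ex Tb i, entry_ex Tb j);
    rewrite !entry_rowE // !entry_colE // => h1 h2.
    by have := Trow _ _ h1 h2; rewrite !ffunE.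
  by have := Tcol _ _ h1 h2; rewrite !ffunE.
split=> [|b b' h1 h2|b b' h1 h2]; first exact: translate_bij.
  by rewrite !ffunE; apply: wrow; rewrite ?entry_rowE ?entry_colE.
by rewrite !ffunE; apply: wcol; rewrite ?entry_rowE ?entry_colE.
Qed.

(** The three claims over an algebraically closed field with a conjugation; the
    conjugation is used only to have a positive definite form. *)
Lemma specht_B_module (S : box la -> nat) :
    (exists F, specht_B C n S F /\ F <> 0) ->
  [/\ forall F, specht_B C n S F -> F <> 0,
      Sn_submodule (mpoly_span (specht_B C n S))
    & Sn_isomorphic (mpoly_span (specht_B C n S)) (specht_module C n la)].
Proof.
move=> [_ [[T0 T0S <-] F0]]; have [Tb _ _] := T0S.
set F := specht_F C S T0 in F0.
pose ro := entry_row T0; pose co := entry_col T0.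
have diag : diagram_coordinates ro co := filling_coordinates Tb.
pose g := specht C ro co.
have T01 : translate T0 1%g = T0 by apply/ffunP => b; rewrite ffunE perm1.
have std1 : standard ro co 1%g by apply/SYT_translate; rewrite ?T01.
have BP p : specht_B C n S p <-> exists2 w, standard ro co w & p = msym w F.
  split=> [[T TS <-]|[w /(SYT_translate _ Tb) wS ->]]; last first.
    by exists (translate T0 w); rewrite ?specht_F_translate.
  have [Tb' _ _] := TS; have [w Tw] := translate_ex Tb Tb'.
  exists w; first by apply/SYT_translate; rewrite -?Tw.
  by rewrite Tw specht_F_translate.
have GP p :
    [set specht_polynomial C T | T in [set T : filling n la | bijective T]]%classic p
    <-> exists2 w, True & p = msym w g.
  rewrite /g -specht_polynomialE //.
  split=> [[T /= Tb' <-]|[w _ ->]]; last first.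
    exists (translate T0 w); rewrite /= ?specht_polynomial_translate //.
    exact: translate_bij.
  have [w ->] := translate_ex Tb Tb'.
  by exists w; rewrite ?specht_polynomial_translate.
have annih a : act a F = 0 <-> act a g = 0.
  have [q gE] : exists q, g = ysym ro co q := specht_eq_ysym C diag.
  have FE : F = ysym ro co (filling_monomial C T0 S) by apply: young_symmetrizerE.
  have g_neq0 : ysym ro co q != 0 by rewrite -gE specht_neq0.
  have F_neq0 : ysym ro co (filling_monomial C T0 S) != 0 by rewrite -FE; apply/eqP.
  rewrite gE FE; split.
    exact: (act_ysym_eq0 diag _ F_neq0).
  exact: (act_ysym_eq0 diag _ g_neq0).
have BE p : mpoly_span (specht_B C n S) p <-> exists a, p = act a F.
  split=> [/(mpoly_span_translates std1 BP)[a _ ->]|[a ->]]; first by exists a.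
  have ex w : exists b : 'S_n -> C,
      (forall u, b u != 0 -> standard ro co u) /\ msym w F = act b F.
    have [b bS /eqP] := specht_straightening C diag w.
    rewrite -subr_eq0 -(act_delta w) -actBl => /eqP/annih/eqP.
    by rewrite actBl subr_eq0 act_delta => /eqP; exists b.
  have [b bP] := fin_all_exists ex.
  apply/(mpoly_span_translates std1 BP).
  exists (fun u => \sum_w a w * b w u).
    move=> u /eqP cu0; apply: contrapT => Nu; apply: cu0; rewrite big1 // => w _.
    have [->|/(bP w).1//] := eqVneq (b w u) 0; exact: mulr0.
  rewrite {1}/act; under [LHS]eq_bigr => w _ do
    rewrite (bP w).2 /act scaler_sumr.
  rewrite exchange_big; apply: eq_bigr => u _ /=; rewrite scaler_suml.
  by apply: eq_bigr => w _; rewrite scalerA.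
have GE p : specht_module C n la p <-> exists a, p = act a g.
  split=> [/(mpoly_span_translates I GP)[a _ ->]|[a ->]]; first by exists a.
  by apply/(mpoly_span_translates I GP); exists a.
split=> [p /BP[w _ ->]| |].
- by rewrite -(msym0 _ w) => /inj_msym.
- exact: cyclic_submodule BE.
- exact: cyclic_isomorphic BE GE annih.
Qed.

End Fillings.

Theorem proposition1p6 (R : realType) (n : nat) (la : seq nat)
    (S : box la -> nat) :
  is_partition n la ->
  (exists F, specht_B R[i] n S F /\ F <> 0) ->
  [/\ forall F, specht_B R[i] n S F -> F <> 0,
      Sn_submodule (mpoly_span (specht_B R[i] n S))
    & Sn_isomorphic (mpoly_span (specht_B R[i] n S)) (specht_module R[i] n la)].
Proof. by move=> la_part; apply: specht_B_module. Qed.
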